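(* Let $3\le n\le N$. For every $x$ at which all the functions $\Theta_n,\Lambda_n(\cdot;i,k)$ ($i,k\in\{1,2\}$) are defined at both $x$ and $x-1$ and $\Lambda_n(x;1,1)\neq 0$, $$\mathcal F_n(x)\nabla^2\mathbb K_n(x)+\mathcal G_n(x)\nabla\mathbb K_n(x)+\mathcal H_n(x)\mathbb K_n(x)=0,$$ where $\nabla^2=\nabla\circ\nabla$, $\mathcal F_n(x)=\Theta_n(x)\Theta_n(x-1)$, $$\mathcal G_n(x)=\Theta_n(x)\big(\nabla\Theta_n(x)+\Lambda_n(x-1;2,1)+\Lambda_n(x;1,2)\big)-\frac{\nabla\Lambda_n(x;1,1)\,\big(\Theta_n(x)+\Lambda_n(x;1,2)\big)\Theta_n(x)}{\Lambda_n(x;1,1)},$$ $$\mathcal H_n(x)=\Theta_n(x)\nabla\Lambda_n(x;2,1)+\Lambda_n(x;1,2)\Lambda_n(x;2,1)-\frac{\nabla\Lambda_n(x;1,1)\,\Lambda_n(x;2,1)\big(\Theta_n(x)+\Lambda_n(x;1,2)\big)}{\Lambda_n(x;1,1)}-\Lambda_n(x-1;1,1)\Lambda_n(x;2,2).$$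
   Context: Fix an integer $N\ge 1$ and $0<p<1$. Notation: $(a)_0=1$, $(a)_k=a(a+1)\cdots(a+k-1)$ (Pochhammer symbol); $[z]_0=1$, $[z]_k=z(z-1)\cdots(z-k+1)$ (falling factorial). For a function $f$, $\Delta f(x)=f(x+1)-f(x)$, $\nabla f(x)=f(x)-f(x-1)$, $\Delta^0$ is the identity and $\Delta^k=\Delta\circ\Delta^{k-1}$. For $0\le n\le N$ the monic Kravchuk polynomial is $K_n(x)=p^n(-N)_n\sum_{k=0}^{n}\frac{(-n)_k(-x)_k}{(-N)_k\,k!}p^{-k}$, and $K_{-1}=0$; these are monic of degree $n$ and orthogonal on $\{0,\dots,N\}$ with respect to the binomial weight $w(x)=\binom{N}{x}p^x(1-p)^{N-x}$, with $\|K_n\|^2=\sum_{x=0}^N K_n(x)^2w(x)=n!(-N)_np^n(p-1)^n$. They satisfy $xK_n=K_{n+1}+\alpha_nK_n+\beta_nK_{n-1}$ with $\alpha_n=p(N-n)+n(1-p)$, $\beta_n=np(1-p)(N-n+1)$. For $1\le n\le N+1$ and integers $i,l\ge0$, $\mathscr K_{n-1}^{(i,l)}(x,y)=\sum_{k=0}^{n-1}\frac{\Delta^iK_k(x)\,\Delta^lK_k(y)}{\|K_k\|^2}$. Fix $\lambda,\mu>0$ and an integer $j\ge 0$. On real polynomials define $\langle f,g\rangle_{\lambda,\mu}=\sum_{x=0}^N f(x)g(x)w(x)+\lambda\Delta^jf(0)\Delta^jg(0)+\mu\Delta^jf(N)\Delta^jg(N)$. For $0\le n\le N$, $\mathbb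 K_n=\mathbb K_n^{(j)}$ is the monic polynomial of degree $n$ with $\langle\mathbb K_n,q\rangle_{\lambda,\mu}=0$ for all polynomials $q$ of degree $<n$ (Kravchuk–Sobolev polynomials). For $1\le n\le N$: $\mathscr A_n(x,y)=\frac{j!}{\|K_{n-1}\|^2[x-y]_{j+1}}\sum_{k=0}^{j}\frac{\Delta^kK_{n-1}(y)}{k!}[x-y]_k$, $\mathscr B_n(x,y)=-\frac{j!}{\|K_{n-1}\|^2[x-y]_{j+1}}\sum_{k=0}^{j}\frac{\Delta^kK_{n}(y)}{k!}[x-y]_k$; $k_{00}=\mathscr K^{(j,j)}_{n-1}(0,0)$, $k_{0N}=\mathscr K^{(j,j)}_{n-1}(0,N)$, $k_{N0}=\mathscr K^{(j,j)}_{n-1}(N,0)$, $k_{NN}=\mathscr K^{(j,j)}_{n-1}(N,N)$, $d_0=\Delta^jK_n(0)$, $d_N=\Delta^jK_n(N)$, $\delta_n=(1+\lambda k_{00})(1+\mu k_{NN})-\lambda\mu k_{0N}k_{N0}$ (which is nonzero), $\Phi_1(n)=\frac{d_0(1+\mu k_{NN})-\mu k_{0N}d_N}{\delta_n}$, $\Phi_2(n)=\frac{(1+\lambda k_{00})d_N-\lambda k_{N0}d_0}{\delta_n}$; $\mathscr C_{1,n}(x)=1-\lambda\Phi_1(n)\mathscr A_n(x,0)-\mu\Phi_2(n)\mathscr A_n(x,N)$ and $\mathscr D_{1,n}(x)=-\lambda\Phi_1(n)\mathscr B_n(x,0)-\mu\Phi_2(n)\mathscr B_n(x,N)$. For $2\le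 m\le N$ define $\mathscr E_{1,m}(x)=x\nabla\mathscr C_{1,m}(x)+m\,\mathscr C_{1,m}(x-1)-\frac{(m-1)p(N-m+2)\mathscr D_{1,m}(x-1)}{\beta_{m-1}}$ and $\mathscr F_{1,m}(x)=x\nabla\mathscr D_{1,m}(x)+mp(N-m+1)\mathscr C_{1,m}(x-1)+\frac{(m-1)p(N-m+2)(x-\alpha_{m-1})\mathscr D_{1,m}(x-1)}{\beta_{m-1}}+(m-1)\mathscr D_{1,m}(x-1)$. For $3\le n\le N$ define $\mathscr C_{2,n}(x)=-\frac{\mathscr D_{1,n-1}(x)}{\beta_{n-1}}$, $\mathscr D_{2,n}(x)=\mathscr C_{1,n-1}(x)+\mathscr C_{2,n}(x)(\alpha_{n-1}-x)$, $\mathscr E_{2,n}(x)=-\frac{\mathscr F_{1,n-1}(x)}{\beta_{n-1}}$, $\mathscr F_{2,n}(x)=\mathscr E_{1,n-1}(x)+\mathscr E_{2,n}(x)(\alpha_{n-1}-x)$, and $\Theta_n(x)=x\big(\mathscr C_{1,n}(x)\mathscr D_{2,n}(x)-\mathscr C_{2,n}(x)\mathscr D_{1,n}(x)\big)$, $\Lambda_n(x;i,k)=(-1)^k\big(\mathscr E_{k,n}(x)\mathscr D_{i,n}(x)-\mathscr F_{k,n}(x)\mathscr C_{i,n}(x)\big)$ for $i,k\in\{1,2\}$. *)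

(* Defs.v *)
From mathcomp Require Import all_boot all_order all_algebra.
Set Implicit Arguments. Unset Strict Implicit. Unset Printing Implicit Defensive.
Import Order.TTheory GRing.Theory Num.Theory.
Local Open Scope ring_scope.

Section Operators.
Context {R : realFieldType}.

Definition Delta (f : R -> R) : R -> R := fun x => f (x + 1) - f x.
Definition Nabla (f : R -> R) : R -> R := fun x => f x - f (x - 1).
Definition DeltaN (i : nat) (f : R -> R) : R -> R := iter i Delta f.

Definition poch (a : R) (k : nat) : R := \prod_(i < k) (a + i%:R).
Definition fall (z : R) (k : nat) : R := \prod_(i < k) (z - i%:R).
End Operators.

Section Kravchuk.
Context {R : realFieldType} (N : nat) (p lam mu : R) (j : nat).

Let Nr : R := N%:R.

(* monic Kravchuk polynomial K_n, as a function of x *)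
Definition Kr (n : nat) (x : R) : R :=
  p ^+ n * poch (- Nr) n *
  \sum_(k < n.+1) (poch (- n%:R) k * poch (- x) k / (poch (- Nr) k * k`!%:R)
                   * p ^- k).

Definition wt (x : nat) : R := 'C(N, x)%:R * p ^+ x * (1 - p) ^+ (N - x).

Definition nrm (n : nat) : R := \sum_(x < N.+1) (Kr n x%:R) ^+ 2 * wt x.

Definition alpha (n : nat) : R := p * (Nr - n%:R) + n%:R * (1 - p).
Definition beta (n : nat) : R := n%:R * p * (1 - p) * (Nr - n%:R + 1).

(* kernel K_{n-1}^{(i,l)}(x,y) = sum_{k=0}^{n-1} ... *)
Definition kern (n i l : nat) (x y : R) : R :=
  \sum_(k < n) DeltaN i (Kr k) x * DeltaN l (Kr k) y / nrm k.

Definition An (n : nat) (x y : R) : R :=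
  j`!%:R / (nrm n.-1 * fall (x - y) j.+1) *
  \sum_(k < j.+1) DeltaN k (Kr n.-1) y / k`!%:R * fall (x - y) k.

Definition Bn (n : nat) (x y : R) : R :=
  - (j`!%:R / (nrm n.-1 * fall (x - y) j.+1)) *
  \sum_(k < j.+1) DeltaN k (Kr n) y / k`!%:R * fall (x - y) k.

Definition k00 n := kern n j j 0 0.
Definition k0N n := kern n j j 0 Nr.
Definition kN0 n := kern n j j Nr 0.
Definition kNN n := kern n j j Nr Nr.
Definition d0 n := DeltaN j (Kr n) 0.
Definition dN n := DeltaN j (Kr n) Nr.
Definition deltan n := (1 + lam * k00 n) * (1 + mu * kNN n) - lam * mu * k0N n * kN0 n.
Definition Phi1 n := (d0 n * (1 + mu * kNN n) - mu * k0N n * dN n) / deltan n.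
Definition Phi2 n := ((1 + lam * k00 n) * dN n - lam * kN0 n * d0 n) / deltan n.

Definition C1 (n : nat) (x : R) : R :=
  1 - lam * Phi1 n * An n x 0 - mu * Phi2 n * An n x Nr.
Definition D1 (n : nat) (x : R) : R :=
  - lam * Phi1 n * Bn n x 0 - mu * Phi2 n * Bn n x Nr.

Definition E1 (m : nat) (x : R) : R :=
  x * Nabla (C1 m) x + m%:R * C1 m (x - 1)
  - (m.-1)%:R * p * (Nr - m%:R + 2) * D1 m (x - 1) / beta m.-1.
Definition F1 (m : nat) (x : R) : R :=
  x * Nabla (D1 m) x + m%:R * p * (Nr - m%:R + 1) * C1 m (x - 1)
  + (m.-1)%:R * p * (Nr - m%:R + 2) * (x - alpha m.-1) * D1 m (x - 1) / beta m.-1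
  + (m.-1)%:R * D1 m (x - 1).

Definition C2 (n : nat) (x : R) : R := - D1 n.-1 x / beta n.-1.
Definition D2 (n : nat) (x : R) : R := C1 n.-1 x + C2 n x * (alpha n.-1 - x).
Definition E2 (n : nat) (x : R) : R := - F1 n.-1 x / beta n.-1.
Definition F2 (n : nat) (x : R) : R := E1 n.-1 x + E2 n x * (alpha n.-1 - x).

Definition Ci (i n : nat) := if i == 1%N then C1 n else C2 n.
Definition Di (i n : nat) := if i == 1%N then D1 n else D2 n.
Definition Ei (k n : nat) := if k == 1%N then E1 n else E2 n.
Definition Fi (k n : nat) := if k == 1%N then F1 n else F2 n.

Definition Theta (n : nat) (x : R) : R :=
  x * (C1 n x * D2 n x - C2 n x * D1 n x).

Definition Lam (n : nat) (i k : nat) (x : R) : R :=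
  (-1) ^+ k * (Ei k n x * Di i n x - Fi k n x * Ci i n x).

Definition Fcal (n : nat) (x : R) : R := Theta n x * Theta n (x - 1).
Definition Gcal (n : nat) (x : R) : R :=
  Theta n x * (Nabla (Theta n) x + Lam n 2 1 (x - 1) + Lam n 1 2 x)
  - Nabla (Lam n 1 1) x * (Theta n x + Lam n 1 2 x) * Theta n x / Lam n 1 1 x.
Definition Hcal (n : nat) (x : R) : R :=
  Theta n x * Nabla (Lam n 2 1) x + Lam n 1 2 x * Lam n 2 1 x
  - Nabla (Lam n 1 1) x * Lam n 2 1 x * (Theta n x + Lam n 1 2 x) / Lam n 1 1 x
  - Lam n 1 1 (x - 1) * Lam n 2 2 x.

Definition sip (f g : R -> R) : R :=
  \sum_(x < N.+1) f x%:R * g x%:R * wt x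
  + lam * DeltaN j f 0 * DeltaN j g 0 + mu * DeltaN j f Nr * DeltaN j g Nr.

Definition is_KS (n : nat) (P : {poly R}) : Prop :=
  P \is monic /\ size P = n.+1 /\
  forall q : {poly R}, (size q <= n)%N -> sip (fun t => P.[t]) (fun t => q.[t]) = 0.

(* the only denominators in Theta_n, Lambda_n that can vanish as functions of x
   are [x-0]_{j+1} and [x-N]_{j+1}; "all functions defined at x" thus means: *)
Definition regular_pt (x : R) : Prop := fall x j.+1 != 0 /\ fall (x - Nr) j.+1 != 0.

End Kravchuk.

(* Main.v *)
Require Import Defs.
From mathcomp Require Import all_boot all_order all_algebra.
From mathcomp Require Import ring lra.
Import Order.TTheory GRing.Theory Num.Theory.
Local Open Scope ring_scope.
Set Implicit Arguments. Unset Strict Implicit. Unset Printing Implicit Defensive.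

(** In the basis of falling factorials the Kravchuk polynomials have coefficients
    C(n,k) (-p)^(n-k) [N-k]_(n-k), and the three-term recurrence, the lowering relation
    x Nabla K_n = n K_n + n p (N-n+1) K_(n-1) and the eigenvalue equation of the Kravchuk
    difference operator reduce to two-term recurrences for these coefficients.
    Orthogonality follows from self-adjointness of that operator, and Christoffel-Darboux
    from the recurrence.  Expanding a Kravchuk-Sobolev polynomial in the K_k gives
    P = K_n - lam Phi_1 kern(.,0) - mu Phi_2 kern(.,N), where (Phi_1, Phi_2) solves a 2x2
    linear system whose determinant is at least 1 by Cauchy-Schwarz; a discrete Leibniz rule
    applied to Christoffel-Darboux turns this into P = C_1 K_n + D_1 K_(n-1).
    Together with the lowering relation, P and its degree n-1 companion v then satisfy
    Theta Nabla P = - Lam_21 P + Lam_11 v and Theta Nabla v = Lam_22 P - Lam_12 v, and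
    eliminating v gives the second-order equation. *)

Local Arguments DeltaN : simpl never.

(** * Falling factorials and their differences *)

Section FallingFactorials.
Context {R : realFieldType}.
Implicit Types (x y z : R) (f g : R -> R).

Lemma fall0 x : fall x 0 = 1. Proof. by rewrite /fall big_ord0. Qed.

Lemma fallSr x k : fall x k.+1 = fall x k * (x - k%:R).
Proof. by rewrite /fall big_ord_recr. Qed.

Lemma fallSl x k : fall x k.+1 = x * fall (x - 1) k.
Proof.
rewrite /fall big_ord_recl subr0; congr (_ * _).
by apply: eq_bigr => i _; rewrite /= /bump /= natrD opprD addrA.
Qed.

Lemma fallD x k l : fall x (k + l) = fall x k * fall (x - k%:R) l.
Proof.
elim: l => [|l IH]; first by rewrite addn0 fall0 mulr1.
by rewrite addnS !fallSr IH natrD opprD addrA mulrA.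
Qed.

Lemma pochN x k : poch (- x) k = (-1) ^+ k * fall x k.
Proof.
elim: k => [|k IH]; first by rewrite /poch big_ord0 fall0 mulr1.
rewrite /poch big_ord_recr /= -/(poch _ _) IH fallSr exprS; ring.
Qed.

Lemma fall_nat n k : fall n%:R k = (n ^_ k)%:R :> R.
Proof.
elim: k => [|k IH]; first by rewrite fall0 ffactn0.
rewrite fallSr IH ffactnSr natrM; case: (leqP k n) => kn; first by rewrite natrB.
by rewrite ffact_small // !mul0r.
Qed.

Lemma Delta_fall x k : Delta (fun t => fall t k) x = k%:R * fall x k.-1.
Proof.
case: k => [|k]; rewrite /Delta ?fall0 ?subrr ?mul0r // fallSl addrK fallSr -natr1 /=; ring.
Qed.

(** Falling factorials diagonalise [x Nabla], as powers diagonalise [x d/dx]. *)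
Lemma mulx_Nabla_fall x k : x * Nabla (fun t => fall t k) x = k%:R * fall x k.
Proof.
case: k => [|k]; rewrite /Nabla ?fall0 ?subrr ?mul0r ?mulr0 //.
rewrite fallSr [fall (x - 1) k.+1]fallSr.
have := fallSl x k; rewrite fallSr => e.
rewrite mulrBr [X in _ - X]mulrA -e -natr1; ring.
Qed.

End FallingFactorials.

(** * Iterated differences and a discrete Leibniz rule *)

Section DifferenceOperators.
Context {R : realFieldType}.
Implicit Types (x y z : R) (f g : R -> R).

Lemma DeltaNS i f x : DeltaN i.+1 f x = DeltaN i f (x + 1) - DeltaN i f x.
Proof. by []. Qed.

Lemma eq_DeltaN i f g : f =1 g -> DeltaN i f =1 DeltaN i g.
Proof. by move=> fg; elim: i => [|i IH] x //; rewrite !DeltaNS !IH. Qed.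

Lemma DeltaND i f g x : DeltaN i (fun t => f t + g t) x = DeltaN i f x + DeltaN i g x.
Proof. by elim: i x => [|i IH] x //; rewrite !DeltaNS !IH; ring. Qed.

Lemma DeltaNZ i a f x : DeltaN i (fun t => a * f t) x = a * DeltaN i f x.
Proof. by elim: i x => [|i IH] x //; rewrite !DeltaNS !IH; ring. Qed.

Lemma DeltaN_sum i m (a : 'I_m -> R) (f : 'I_m -> R -> R) x :
  DeltaN i (fun t => \sum_(k < m) a k * f k t) x = \sum_(k < m) a k * DeltaN i (f k) x.
Proof.
elim: i x => [|i IH] x //; rewrite !DeltaNS !IH -sumrB.
by apply: eq_bigr => k _; rewrite DeltaNS mulrBr.
Qed.

(** Discrete Leibniz rule: [x - t] has degree one in [t], so only two terms survive. *)
Lemma DeltaN_sub_mul i x g y :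
  DeltaN i.+1 (fun t => (x - t) * g t) y
  = (x - y - i.+1%:R) * DeltaN i.+1 g y - i.+1%:R * DeltaN i g y.
Proof.
elim: i y => [|i IH] y; first by rewrite /DeltaN /= /Delta; ring.
rewrite DeltaNS !IH !(DeltaNS i.+1) !(DeltaNS i) -!natr1; ring.
Qed.

(** Iterated difference of [f t / (x - t)], with denominators cleared; the sum is the Newton
    expansion of [f] at [y], truncated and evaluated at [x]. [DeltaN_sub_mul] supplies each new
    Newton term. *)
Lemma DeltaN_div_sub i x f g y :
  (forall t, (x - t) * g t = f t) ->
  fall (x - y) i.+1 * DeltaN i g y
  = i`!%:R * \sum_(k < i.+1) DeltaN k f y / k`!%:R * fall (x - y) k.
Proof.
move=> fE; elim: i => [|i IH].
  rewrite big_ord1 fallSr fall0 /DeltaN /= -fE fact0 divr1; ring.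
have := DeltaN_sub_mul i x g y; rewrite (eq_DeltaN i.+1 fE y) => e.
rewrite big_ord_recr /= [RHS]mulrDr [in X in _ = X + _]factS natrM -mulrA -IH e fallSr.
by field; rewrite addrC natr1 !pnatr_eq0 -lt0n fact_gt0.
Qed.

End DifferenceOperators.

(** * Expansion in a monic basis *)

Section PolynomialBases.
Context {R : realFieldType}.

Lemma monic_basis (Q : nat -> {poly R}) :
    (forall k, Q k \is monic) -> (forall k, size (Q k) = k.+1) ->
  forall m (q : {poly R}), (size q <= m)%N ->
  exists a : nat -> R, q = \sum_(k < m) a k *: Q k.
Proof.
move=> mQ sQ; elim=> [|m IH] q sq.
  exists (fun=> 0); rewrite big_ord0; apply/eqP; by rewrite -size_poly_leq0.
have [a qE] : exists a : nat -> R, q - q`_m *: Q m = \sum_(k < m) a k *: Q k.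
  apply: IH; apply/leq_sizeP => i; rewrite leq_eqVlt => /orP[/eqP <-|mi].
    have := mQ m; rewrite monicE lead_coefE sQ /= coefB coefZ => /eqP ->.
    by rewrite mulr1 subrr.
  rewrite coefB coefZ nth_default; last by apply: leq_trans sq _.
  by rewrite [(Q m)`_i]nth_default ?mulr0 ?subrr // sQ.
exists (fun k => if k == m then q`_m else a k).
rewrite big_ord_recr /= eqxx -[LHS](subrK (q`_m *: Q m)) qE; congr (_ + _).
by apply: eq_bigr => k _; rewrite ltn_eqF.
Qed.

End PolynomialBases.

(** * Kravchuk polynomials: recurrences, eigenvalue equation, orthogonality *)

Section KravchukPolynomials.
Context {R : realFieldType} (N : nat) (p : R).
Implicit Types (x y : R) (f g : R -> R).

(** The quotient of [poch (- N%:R) n] by [poch (- N%:R) k] is written as a signed falling factorial,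
    so no division remains. *)
Definition Kcoef (n k : nat) : R :=
  'C(n, k)%:R * (- p) ^+ (n - k) * fall (N%:R - k%:R) (n - k).

(* Unlike [Kr], whose prefactor [poch (- N%:R) n] vanishes for [n > N], this is
   monic for every [n], so the recurrences below hold without bound on [n]. *)
Definition Kpoly (n : nat) : {poly R} :=
  \sum_(k < n.+1) Kcoef n k *: \prod_(i < k) ('X - (i%:R)%:P).

Local Notation K n := (horner (Kpoly n)).

Lemma Kcoefnn n : Kcoef n n = 1.
Proof. by rewrite /Kcoef subnn binn fall0 expr0 !mulr1. Qed.

Lemma Kcoef_small n k : (n < k)%N -> Kcoef n k = 0.
Proof. by move=> nk; rewrite /Kcoef bin_small // !mul0r. Qed.

(** The factor [n.+1 - k] stays uncancelled so that the identity covers every [k]. *)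
Lemma Kcoef_recl n k :
  (n.+1%:R - k%:R) * Kcoef n.+1 k = - (n.+1%:R * p * (N%:R - n%:R)) * Kcoef n k.
Proof.
case: (ltngtP k n.+1) => [kn|nk|->]; last first.
- by rewrite subrr mul0r Kcoef_small ?mulr0.
- by rewrite !Kcoef_small ?mulr0 // ltnW.
have e : (n.+1%:R - k%:R) * 'C(n.+1, k)%:R = n.+1%:R * 'C(n, k)%:R :> R.
  by rewrite -natrB 1?ltnW // -!natrM; congr _%:R; have := mul_bin_down n.+1 k.
rewrite /Kcoef subSn // exprS fallSr natrB // mulrA mulrA e; ring.
Qed.

Lemma Kcoef_recr n k :
  (n%:R - k%:R) * Kcoef n k = - (p * k.+1%:R * (N%:R - k%:R)) * Kcoef n k.+1.
Proof.
case: (ltngtP k n) => [kn|nk|->]; last first.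
- by rewrite subrr mul0r Kcoef_small ?mulr0.
- by rewrite !Kcoef_small ?mulr0 // ltnW.
have e : (n%:R - k%:R) * 'C(n, k)%:R = k.+1%:R * 'C(n, k.+1)%:R :> R.
  rewrite -natrB 1?ltnW // -!natrM; congr _%:R.
  by have := mul_bin_left n k.
rewrite /Kcoef -(subnSK kn) exprS fallSl mulrA mulrA e -(natr1 k) opprD addrA; ring.
Qed.

(** The free bound [M] lets polynomials of different degrees be compared termwise. *)
Lemma KpolyE n x M : (n < M)%N -> K n x = \sum_(k < M) Kcoef n k * fall x k.
Proof.
move=> nM; rewrite /Kpoly horner_sum.
under eq_bigr => k _.
  rewrite hornerZ horner_prod; under eq_bigr do rewrite !hornerE.
  over.
rewrite (big_ord_widen M (fun k => Kcoef n k * fall x k)) //.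
rewrite big_mkcond; apply: eq_bigr => k _; case: ifP => // /negbT.
by rewrite -leqNgt => nk; rewrite Kcoef_small // mul0r.
Qed.

Lemma size_fallp k : size (\prod_(i < k) ('X - (i%:R)%:P) : {poly R}) = k.+1.
Proof. by rewrite size_prod_XsubC /index_enum -enumT size_enum_ord. Qed.

Lemma size_Kpoly_sub n : (size (Kpoly n - \prod_(i < n) ('X - (i%:R)%:P))%R <= n)%N.
Proof.
rewrite /Kpoly big_ord_recr /= Kcoefnn scale1r addrK.
apply: (leq_trans (size_sum _ _ _)); apply/bigmax_leqP => k _.
by apply: leq_trans (size_scale_leq _ _) _; rewrite size_fallp.
Qed.

Lemma size_Kpoly n : size (Kpoly n) = n.+1.
Proof.
rewrite -[Kpoly n](subrK (\prod_(i < n) ('X - (i%:R)%:P))) addrC size_polyDl size_fallp //.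
exact: size_Kpoly_sub.
Qed.

Lemma monic_Kpoly n : Kpoly n \is monic.
Proof.
rewrite -[Kpoly n](subrK (\prod_(i < n) ('X - (i%:R)%:P))) monicE addrC.
rewrite lead_coefDl ?size_fallp; last by rewrite ltnS size_Kpoly_sub.
by rewrite -monicE monic_prod_XsubC.
Qed.

Lemma KrE n x : p != 0 -> (n <= N)%N -> Kr N p n x = K n x.
Proof.
move=> p0 nN; rewrite (KpolyE x (ltnSn n)) /Kr mulr_sumr; apply: eq_bigr => k _.
have kn : (k <= n)%N by rewrite -ltnS.
have e : fall N%:R n = fall N%:R k * fall (N%:R - k%:R) (n - k) :> R.
  by rewrite -fallD subnKC.
have k0 : fall N%:R k != 0 :> R.
  by rewrite fall_nat pnatr_eq0 -lt0n ffact_gt0 (leq_trans kn).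
have f0 : k`!%:R != 0 :> R by rewrite pnatr_eq0 -lt0n fact_gt0.
have s0 : (-1) ^+ k != 0 :> R by rewrite expf_neq0 // oppr_eq0 oner_eq0.
have sn : (-1) ^+ n = (-1) ^+ k * (-1) ^+ (n - k) :> R by rewrite -exprD subnKC.
have pn : p ^+ n = p ^+ k * p ^+ (n - k) by rewrite -exprD subnKC.
have pk : p ^+ k != 0 by rewrite expf_neq0.
have ss : (-1) ^+ k * (-1) ^+ k = 1 :> R by rewrite -exprD addnn -signr_odd odd_double.
rewrite /Kcoef !pochN e (fall_nat n k) -bin_ffact natrM [(- p) ^+ _]exprNn sn pn.
(* The square of [(-1) ^+ k] is isolated because [field] does not know that it is 1. *)
transitivity ((-1) ^+ k * (-1) ^+ k * ('C(n, k)%:R * ((-1) ^+ (n - k) * p ^+ (n - k))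
    * fall (N%:R - k%:R) (n - k) * fall x k)); last by rewrite ss mul1r.
by field; rewrite ?p0 ?k0 ?f0 ?s0 ?pk.
Qed.

Lemma Kpoly_lowering n x :
  x * Nabla (K n.+1) x = n.+1%:R * K n.+1 x + n.+1%:R * p * (N%:R - n%:R) * K n x.
Proof.
rewrite /Nabla !(@KpolyE _ _ n.+2) // -sumrB !mulr_sumr -big_split.
apply: eq_bigr => k _ /=.
have -> : x * (Kcoef n.+1 k * fall x k - Kcoef n.+1 k * fall (x - 1) k)
        = Kcoef n.+1 k * (x * Nabla (fun t => fall t k) x) by rewrite /Nabla; ring.
rewrite mulx_Nabla_fall.
have -> : n.+1%:R * p * (N%:R - n%:R) * (Kcoef n k * fall x k)
        = - ((n.+1%:R - k%:R) * Kcoef n.+1 k) * fall x k by rewrite Kcoef_recl; ring.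
ring.
Qed.

(** Coefficient of [fall x k] in the three-term recurrence; the left side comes from [x [x]_l =
    [x]_(l+1) + l [x]_l]. *)
Lemma Kcoef_rec3 n k : (k <= n.+1)%N ->
  (if k is l.+1 then Kcoef n.+1 l else 0) + k%:R * Kcoef n.+1 k
  = Kcoef n.+2 k + alpha N p n.+1 * Kcoef n.+1 k + beta N p n.+1 * Kcoef n k.
Proof.
(* After this multiplication every term is a multiple of [Kcoef n.+1 k]. *)
move=> kn; apply: (@mulfI _ (n.+2%:R - k%:R)).
  by rewrite subr_eq0 eqr_nat gtn_eqF.
rewrite !mulrDr Kcoef_recl.
have -> : (n.+2%:R - k%:R) * (if k is l.+1 then Kcoef n.+1 l else 0)
   = - (p * k%:R * (N%:R - k%:R + 1)) * Kcoef n.+1 k.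
  case: k kn => [|l] _; first by rewrite !mulr0 mul0r oppr0 mul0r.
  have := Kcoef_recr n.+1 l; rewrite -[n.+2%:R]natr1 -[in X in _ -> X](natr1 l) => e.
  transitivity ((n.+1%:R - l%:R) * Kcoef n.+1 l); first by ring.
  by rewrite e -!natr1; ring.
have -> : beta N p n.+1 * Kcoef n k = - (1 - p) * ((n.+1%:R - k%:R) * Kcoef n.+1 k).
  by rewrite Kcoef_recl /beta -!natr1; ring.
rewrite /alpha -!natr1; ring.
Qed.

Lemma Kpoly_rec3 n x :
  K n.+2 x = (x - alpha N p n.+1) * K n.+1 x - beta N p n.+1 * K n x.
Proof.
suff e : x * K n.+1 x = K n.+2 x + alpha N p n.+1 * K n.+1 x + beta N p n.+1 * K n x.
  by rewrite mulrBl e; ring.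
have -> : x * K n.+1 x = \sum_(k < n.+3)
     ((if (k : nat) is l.+1 then Kcoef n.+1 l else 0) + k%:R * Kcoef n.+1 k) * fall x k.
  transitivity (\sum_(k < n.+3) (if (k : nat) is l.+1 then Kcoef n.+1 l else 0) * fall x k
     + \sum_(k < n.+3) k%:R * Kcoef n.+1 k * fall x k); last first.
    by rewrite -big_split; apply: eq_bigr => k _; rewrite /= mulrDl.
  rewrite [X in X + _]big_ord_recl /= mul0r add0r.
  rewrite [X in _ + X]big_ord_recr /= Kcoef_small // mulr0 mul0r addr0 -big_split /=.
  rewrite (KpolyE x (ltnSn _)) mulr_sumr; apply: eq_bigr => k _.
  rewrite /bump /= fallSr; ring.
rewrite !(@KpolyE _ _ n.+3) ?ltnS ?leqW // !mulr_sumr -!big_split; apply: eq_bigr => k _ /=.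
(* The top index [n.+2], outside [Kcoef_rec3], compares leading coefficients. *)
have := ltn_ord k; rewrite ltnS leq_eqVlt => /orP[/eqP ->|kn].
  by rewrite (@Kcoef_small n.+1 n.+2) // (@Kcoef_small n n.+2) ?ltnS ?leqW // !Kcoefnn; ring.
by rewrite Kcoef_rec3 //; ring.
Qed.

Lemma Kpoly_rec1 x : K 1%N x = (x - alpha N p 0) * K 0%N x.
Proof.
rewrite !(@KpolyE _ _ 2) // !big_ord_recl !big_ord0 /Kcoef /= /bump /=.
rewrite !subnn /= /alpha !(fall0, fallSr) ?(bin0, bin1) /=.
rewrite /= !expr0 ?expr1; ring.
Qed.

(* At [n = 0] the junk value [0.-1 = 0] is harmless since [beta 0 = 0]. *)
Lemma Kpoly_rec n x :
  K n.+1 x = (x - alpha N p n) * K n x - beta N p n * K n.-1 x.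
Proof.
case: n => [|n]; last exact: Kpoly_rec3.
by rewrite Kpoly_rec1 /beta !mul0r subr0.
Qed.

(* Self-adjoint for the binomial weight, with the [Kpoly n] as eigenvectors for the
   distinct eigenvalues [- n]: hence their orthogonality. *)
Definition Kop f x : R := p * (N%:R - x) * Delta f x - (1 - p) * (x * Nabla f x).

Lemma Kop_Kpoly n x : Kop (K n) x = - n%:R * K n x.
Proof.
rewrite /Kop /Delta /Nabla !(@KpolyE _ _ n.+2) // -!sumrB !mulr_sumr -!sumrB.
(* Writing [N - x = (N - k + 1) - (x - k + 1)] turns part of the [p] term into [- p k [x]_k], which
   joins the [1 - p] term. *)
transitivity (\sum_(k < n.+2) (Kcoef n k * p * k%:R * (N%:R - k%:R + 1) * fall x k.-1
                               - k%:R * Kcoef n k * fall x k)).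
  apply: eq_bigr => k _.
  have := Delta_fall x k; have := mulx_Nabla_fall x k; rewrite /Delta /Nabla => eN eD.
  transitivity (Kcoef n k * (p * (N%:R - x) * (fall (x + 1) k - fall x k)
     - (1 - p) * (x * (fall x k - fall (x - 1) k)))); first by ring.
  rewrite eN eD; case: (k : nat) => [|l]; first by ring.
  by rewrite fallSr -natr1 /=; ring.
rewrite sumrB big_ord_recl /= mulr0 !mul0r add0r.
rewrite [X in _ - X]big_ord_recr [RHS]big_ord_recr /= Kcoef_small // !(mulr0, mul0r) !addr0.
rewrite -sumrB; apply: eq_bigr => k _; rewrite /bump /= add1n.
have e := Kcoef_recr n k.
transitivity ((- (- (p * k.+1%:R * (N%:R - k%:R)) * Kcoef n k.+1) - k%:R * Kcoef n k)
              * fall x k); first by rewrite -!natr1; ring.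
by rewrite -e; ring.
Qed.

(** Pearson equation of the binomial weight, which makes [Kop] self-adjoint. *)
Lemma wtS (x : nat) : (x < N)%N ->
  p * (N%:R - x%:R) * wt N p x = (1 - p) * x.+1%:R * wt N p x.+1.
Proof.
move=> xN; rewrite /wt -(subnSK xN) !exprS.
have e : (N%:R - x%:R) * 'C(N, x)%:R = x.+1%:R * 'C(N, x.+1)%:R :> R.
  by rewrite -natrB 1?ltnW // -!natrM; congr _%:R; have := mul_bin_left N x.
transitivity (((N%:R - x%:R) * 'C(N, x)%:R) * (p * p ^+ x * ((1 - p) * (1 - p) ^+ (N - x.+1)))).
  by ring.
by rewrite e; ring.
Qed.

Definition wip f g : R := \sum_(x < N.+1) f x%:R * g x%:R * wt N p x.

Lemma wipC f g : wip f g = wip g f.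
Proof. by apply: eq_bigr => x _; ring. Qed.

(** Summation by parts; the boundary terms carry the factors [N - x] at [N] and [x] at 0. The result
    is symmetric in [f] and [g]. *)
Lemma Kop_dirichlet f g :
  wip (Kop f) g
  = - \sum_(x < N) p * (N%:R - x%:R) * wt N p x * (Delta f x%:R * Delta g x%:R).
Proof.
rewrite /wip /Kop.
transitivity (\sum_(x < N.+1) p * (N%:R - x%:R) * wt N p x * Delta f x%:R * g x%:R
   - \sum_(x < N.+1) (1 - p) * x%:R * wt N p x * Nabla f x%:R * g x%:R).
  by rewrite -sumrB; apply: eq_bigr => x _; ring.
rewrite big_ord_recr /= subrr mulr0 !mul0r addr0.
rewrite big_ord_recl /= mulr0 !mul0r add0r -sumrB -sumrN.
apply: eq_bigr => x _; rewrite /bump /= add1n -wtS // /Nabla /Delta -natr1 addrK; ring.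
Qed.

Lemma wip_Kpoly m n : m != n -> wip (K m) (K n) = 0.
Proof.
move=> mn.
have sa : wip (Kop (K m)) (K n) = wip (Kop (K n)) (K m).
  by rewrite !Kop_dirichlet; congr (- _); apply: eq_bigr => x _; ring.
have eig a b : wip (Kop (K a)) (K b) = - a%:R * wip (K a) (K b).
  by rewrite /wip mulr_sumr; apply: eq_bigr => x _; rewrite Kop_Kpoly; ring.
move: sa; rewrite !eig (wipC (K n)) => /eqP; rewrite -subr_eq0 -mulrBl mulf_eq0.
by rewrite opprK addrC subr_eq0 eqr_nat eq_sym (negbTE mn) => /eqP.
Qed.

End KravchukPolynomials.

(** * Norms, the Christoffel-Darboux formula and kernel estimates *)

Section ChristoffelDarboux.
Context {R : realFieldType} (N : nat) (p : R).
Context (p_gt0 : 0 < p) (p_lt1 : p < 1).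
Implicit Types (x y : R) (f g : R -> R).

Local Notation K n := (horner (Kpoly N p n)).

Let p_neq0 : p != 0. Proof. exact: lt0r_neq0. Qed.

Lemma wip_rec f n :
  wip N p f (fun t => t * K n t)
  = wip N p f (K n.+1) + alpha N p n * wip N p f (K n) + beta N p n * wip N p f (K n.-1).
Proof.
rewrite /wip !mulr_sumr -!big_split; apply: eq_bigr => x _ /=.
by rewrite Kpoly_rec; ring.
Qed.

Lemma nrmE n : (n <= N)%N -> nrm N p n = wip N p (K n) (K n).
Proof. by move=> nN; apply: eq_bigr => x _; rewrite KrE // expr2. Qed.

(** Multiplication by [x] is symmetric: the product of [K_n] with [x K_(n+1)] is computed by the
    recurrence on either factor. *)
Lemma nrmS n : (n < N)%N -> nrm N p n.+1 = beta N p n.+1 * nrm N p n.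
Proof.
move=> nN; rewrite !nrmE //; last exact: ltnW.
have -> : beta N p n.+1 * wip N p (K n) (K n) = wip N p (K n) (fun t => t * K n.+1 t).
  (* Here [n.+2] may be [N.+1], where [Kpoly] and its orthogonality still make sense. *)
  rewrite wip_rec /= (wip_Kpoly _ _ (n := n.+2)) ?(wip_Kpoly _ _ (n := n.+1)) ?mulr0 ?add0r //.
    by rewrite neq_ltn ltnSn.
  by rewrite neq_ltn ltnS leqnSn.
transitivity (wip N p (K n.+1) (fun t => t * K n t)); last by apply: eq_bigr => x _; ring.
rewrite wip_rec (wip_Kpoly _ _ (n := n)) ?mulr0 ?addr0; last by rewrite neq_ltn ltnSn orbT.
case: n {nN} => [|n]; first by rewrite /beta !mul0r addr0.
by rewrite (wip_Kpoly _ _ (n := n)) ?mulr0 ?addr0 // neq_ltn orbC ltnS leqnSn.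
Qed.

Lemma beta_gt0 n : (0 < n)%N -> (n <= N)%N -> 0 < beta N p n.
Proof.
move=> n0 nN; rewrite /beta !mulr_gt0 ?ltr0n ?subr_gt0 //.
by rewrite ltr_wpDl ?subr_ge0 ?ler_nat.
Qed.

Lemma nrm_gt0 n : (n <= N)%N -> 0 < nrm N p n.
Proof.
elim: n => [|n IH] nN; last by rewrite nrmS // mulr_gt0 ?beta_gt0 // IH // ltnW.
suff -> : nrm N p 0 = 1 by [].
transitivity ((1 - p + p) ^+ N); last by rewrite subrK expr1n.
rewrite nrmE // exprDn; apply: eq_bigr => x _.
rewrite !(@KpolyE _ _ _ _ _ 1) // big_ord1 Kcoefnn fall0 /wt -mulr_natl; ring.
Qed.

Lemma Kr_rec n x : (n < N)%N ->
  Kr N p n.+1 x = (x - alpha N p n) * Kr N p n x - beta N p n * Kr N p n.-1 x.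
Proof.
by move=> nN; rewrite !KrE ?Kpoly_rec // ?(leq_trans (leq_pred _)) // ltnW.
Qed.

Lemma Kr_lowering n x : (n < N)%N ->
  x * Nabla (Kr N p n.+1) x
  = n.+1%:R * Kr N p n.+1 x + n.+1%:R * p * (N%:R - n%:R) * Kr N p n x.
Proof.
by move=> nN; rewrite /Nabla !KrE // 1?ltnW // -Kpoly_lowering.
Qed.

Lemma christoffel_darboux n x y : (n < N)%N ->
  (x - y) * (\sum_(k < n.+1) Kr N p k x * Kr N p k y / nrm N p k)
  = (Kr N p n.+1 x * Kr N p n y - Kr N p n x * Kr N p n.+1 y) / nrm N p n.
Proof.
elim: n => [|n IH] nN.
  by rewrite big_ord1 !Kr_rec // /beta !mul0r !subr0; ring.
rewrite big_ord_recr /= mulrDr IH 1?ltnW // !(@Kr_rec n.+1) // nrmS 1?ltnW //=.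
have b0 : beta N p n.+1 != 0 by rewrite gt_eqF ?beta_gt0 // ltnW.
have n0 : nrm N p n != 0 by rewrite gt_eqF ?nrm_gt0 ?(ltnW (ltnW nN)).
by field; rewrite b0 n0.
Qed.

Context (j : nat).

Lemma kernE n x y : (n < N)%N -> fall (x - y) j.+1 != 0 ->
  kern N p n.+1 0 j x y
  = An N p j n.+1 x y * Kr N p n.+1 x + Bn N p j n.+1 x y * Kr N p n x.
Proof.
(* With [x] fixed, [g] is the kernel in its second variable and Christoffel-Darboux reads
   [(x - t) * g t = f t]. *)
move=> nN f0; pose g t := \sum_(k < n.+1) Kr N p k x / nrm N p k * Kr N p k t.
pose f t := Kr N p n.+1 x / nrm N p n * Kr N p n t
            + - (Kr N p n x / nrm N p n) * Kr N p n.+1 t.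
have fE t : (x - t) * g t = f t.
  transitivity ((x - t) * (\sum_(k < n.+1) Kr N p k x * Kr N p k t / nrm N p k)).
    by congr (_ * _); apply: eq_bigr => k _; ring.
  by rewrite christoffel_darboux // /f; ring.
have -> : kern N p n.+1 0 j x y = DeltaN j g y.
  by rewrite DeltaN_sum; apply: eq_bigr => k _; rewrite /DeltaN /=; ring.
apply: (mulfI f0); rewrite (DeltaN_div_sub j y fE) /An /Bn /=.
have n0 : nrm N p n != 0 by rewrite gt_eqF ?nrm_gt0 // ltnW.
have -> : \sum_(k < j.+1) DeltaN k f y / k`!%:R * fall (x - y) k
  = Kr N p n.+1 x / nrm N p n * (\sum_(k < j.+1) DeltaN k (Kr N p n) y / k`!%:R * fall (x - y) k)
    - Kr N p n x / nrm N p n * (\sum_(k < j.+1) DeltaN k (Kr N p n.+1) y / k`!%:R * fall (x - y) k).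
  rewrite !mulr_sumr -sumrB; apply: eq_bigr => k _.
  by rewrite DeltaND !DeltaNZ; ring.
by field; rewrite f0 n0.
Qed.

Lemma DeltaN_kern n x y : DeltaN j (fun t => kern N p n 0 j t y) x = kern N p n j j x y.
Proof.
rewrite /kern.
rewrite (@eq_DeltaN _ _ _ (fun t => \sum_(k < n) DeltaN j (Kr N p k) y / nrm N p k * Kr N p k t)).
  by rewrite DeltaN_sum; apply: eq_bigr => k _; ring.
by move=> t; apply: eq_bigr => k _; rewrite /DeltaN /=; ring.
Qed.

Lemma kern_ge0 n i x : (n <= N)%N -> 0 <= kern N p n i i x x.
Proof.
move=> nN; apply: sumr_ge0 => k _; rewrite divr_ge0 -?expr2 ?sqr_ge0 //.
by rewrite ltW // nrm_gt0 // (leq_trans (ltnW (ltn_ord k))).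
Qed.

(* Lagrange's identity. *)
Lemma kern_cauchy_schwarz n i x y : (n <= N)%N ->
  kern N p n i i x y * kern N p n i i y x <= kern N p n i i x x * kern N p n i i y y.
Proof.
move=> nN; pose a (k : 'I_n) := DeltaN i (Kr N p k) x; pose b (k : 'I_n) := DeltaN i (Kr N p k) y.
have : 0 <= \sum_(k < n) \sum_(l < n) (a k * b l - a l * b k) ^+ 2 / (nrm N p k * nrm N p l).
  apply: sumr_ge0 => k _; apply: sumr_ge0 => l _.
  by rewrite divr_ge0 ?sqr_ge0 // mulr_ge0 // ltW // nrm_gt0 // (leq_trans (ltnW (ltn_ord _))).
have -> : \sum_(k < n) \sum_(l < n) (a k * b l - a l * b k) ^+ 2 / (nrm N p k * nrm N p l)
  = kern N p n i i x x * kern N p n i i y y + kern N p n i i y y * kern N p n i i x x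
    - kern N p n i i x y * kern N p n i i y x - kern N p n i i x y * kern N p n i i y x.
  rewrite /kern !big_distrlr /= -!(big_split, sumrB); apply: eq_bigr => k _.
  rewrite /= -!(big_split, sumrB); apply: eq_bigr => l _ /=.
  by rewrite -/(a k) -/(b k) -/(a l) -/(b l) invfM; ring.
lra.
Qed.

End ChristoffelDarboux.

(** * Kravchuk-Sobolev polynomials: expansion, connection and lowering *)

Section KravchukSobolev.
Context {R : realFieldType} (N : nat) (p lam mu : R) (j : nat).
Context (p_gt0 : 0 < p) (p_lt1 : p < 1) (lam_gt0 : 0 < lam) (mu_gt0 : 0 < mu).
Implicit Types (x y : R) (P : {poly R}).

Local Notation K := (Kr N p).

Let p_neq0 : p != 0. Proof. exact: lt0r_neq0. Qed.

Lemma deltan_neq0 n : (n <= N)%N -> deltan N p lam mu j n != 0.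
Proof.
move=> nN; rewrite gt_eqF // /deltan /k00 /k0N /kN0 /kNN.
have k0 := kern_ge0 p_gt0 p_lt1 j 0 nN; have k1 := kern_ge0 p_gt0 p_lt1 j N%:R nN.
have cs := kern_cauchy_schwarz p_gt0 p_lt1 j 0 N%:R nN.
set a := kern _ _ _ _ _ 0 0 in k0 cs *; set b := kern _ _ _ _ _ N%:R N%:R in k1 cs *.
have la : 0 <= lam * a by rewrite mulr_ge0 // ltW.
have mb : 0 <= mu * b by rewrite mulr_ge0 // ltW.
move: cs; rewrite -subr_ge0 => cs.
have := mulr_ge0 (mulr_ge0 (ltW lam_gt0) (ltW mu_gt0)) cs.
lra.
Qed.

Lemma KS_expansion n P : (n <= N)%N -> is_KS N p lam mu j n P ->
  forall x, P.[x] = K n x - lam * DeltaN j (horner P) 0 * kern N p n 0 j x 0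
                    - mu * DeltaN j (horner P) N%:R * kern N p n 0 j x N%:R.
Proof.
move=> nN [mP [sP oP]] x.
have [a aE] : exists a : nat -> R, P - Kpoly N p n = \sum_(k < n) a k *: Kpoly N p k.
  apply: monic_basis; [exact: monic_Kpoly|exact: size_Kpoly|].
  apply/leq_sizeP => i; rewrite leq_eqVlt coefB => /orP[/eqP <-|ni].
    have := mP; have := monic_Kpoly N p n; rewrite !monicE !lead_coefE sP size_Kpoly /=.
    by move=> /eqP -> /eqP ->; rewrite subrr.
  by rewrite !nth_default ?subrr // ?size_Kpoly ?sP.
have PE t : P.[t] = K n t + \sum_(k < n) a k * K k t.
  rewrite -[P](subrK (Kpoly N p n)) aE hornerD horner_sum addrC KrE //; congr (_ + _).
  apply: eq_bigr => k _; rewrite hornerZ KrE // (leq_trans _ nN) //; exact: ltnW.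
(* Testing [P] against [K_k] with [k < n] isolates [a k]. *)
have ak (k : 'I_n) : a k = (- (lam * DeltaN j (horner P) 0 * DeltaN j (K k) 0)
                     - mu * DeltaN j (horner P) N%:R * DeltaN j (K k) N%:R) / nrm N p k.
  have kN : (k <= N)%N by rewrite (leq_trans _ nN) // ltnW.
  have k0 : nrm N p k != 0 by rewrite gt_eqF // nrm_gt0.
  have := oP (Kpoly N p k); rewrite size_Kpoly ltn_ord => /(_ isT); rewrite /sip.
  have dE z : DeltaN j (fun t => (Kpoly N p k).[t]) z = DeltaN j (K k) z.
    by apply: eq_DeltaN => t; rewrite KrE.
  rewrite !dE -/(wip N p (horner P) (horner (Kpoly N p k))).
  have -> : wip N p (horner P) (horner (Kpoly N p k)) = a k * nrm N p k.
    transitivity (wip N p (horner (Kpoly N p n)) (horner (Kpoly N p k))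
       + \sum_(i < n) a i * wip N p (horner (Kpoly N p i)) (horner (Kpoly N p k))).
      rewrite /wip; under [X in _ + X]eq_bigr do rewrite mulr_sumr.
      rewrite exchange_big -big_split; apply: eq_bigr => t _ /=.
      rewrite -[P](subrK (Kpoly N p n)) aE hornerD horner_sum addrC.
      rewrite 2!mulrDl; congr (_ + _); rewrite !mulr_suml.
      by apply: eq_bigr => i _; rewrite hornerZ; ring.
    rewrite wip_Kpoly ?add0r; last by rewrite neq_ltn ltn_ord orbT.
    rewrite (bigD1 k) //= -nrmE // big1 ?addr0 // => i ik.
    by rewrite wip_Kpoly ?mulr0.
  move=> e; apply: (mulIf k0); rewrite mulfVK //; move: e.
  rewrite -/(horner P); set A := _ * nrm _ _ _; lra.
rewrite PE -addrA; congr (_ + _).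
rewrite /kern !mulr_sumr -sumrN -sumrB; apply: eq_bigr => k _.
by rewrite ak /DeltaN /=; ring.
Qed.

Lemma KS_DeltaN n P : (n <= N)%N -> is_KS N p lam mu j n P ->
  DeltaN j (horner P) 0 = Phi1 N p lam mu j n
  /\ DeltaN j (horner P) N%:R = Phi2 N p lam mu j n.
Proof.
move=> nN hP; have PE := KS_expansion nN hP.
set X := DeltaN j (horner P) 0 in PE *; set Y := DeltaN j (horner P) N%:R in PE *.
have dE z : DeltaN j (horner P) z = DeltaN j (K n) z
    - lam * X * kern N p n j j z 0 - mu * Y * kern N p n j j z N%:R.
  rewrite (@eq_DeltaN _ _ _ (fun t => K n t + (- (lam * X) * kern N p n 0 j t 0
      + - (mu * Y) * kern N p n 0 j t N%:R))); last by move=> t; rewrite PE; ring.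
  rewrite !DeltaND (DeltaNZ _ (- (lam * X))) (DeltaNZ _ (- (mu * Y))) !DeltaN_kern; ring.
have := deltan_neq0 nN; rewrite /Phi1 /Phi2 /d0 /dN => dn0.
(* A linear system in [X] and [Y] with determinant [deltan]; [Phi1] and [Phi2] are its Cramer
   solutions. *)
have eX : DeltaN j (K n) 0 = (1 + lam * k00 N p j n) * X + mu * k0N N p j n * Y.
  by have := dE 0; rewrite -/X /k00 /k0N; lra.
have eY : DeltaN j (K n) N%:R = lam * kN0 N p j n * X + (1 + mu * kNN N p j n) * Y.
  by have := dE N%:R; rewrite -/Y /kN0 /kNN; lra.
by split; apply: (mulIf dn0); rewrite mulfVK // eX eY /deltan; ring.
Qed.

Lemma KS_connection n P x : (0 < n)%N -> (n <= N)%N -> is_KS N p lam mu j n P ->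
  regular_pt N j x ->
  P.[x] = C1 N p lam mu j n x * K n x + D1 N p lam mu j n x * K n.-1 x.
Proof.
case: n => // n _ nN hP [r0 rN]; rewrite (KS_expansion nN hP).
have [-> ->] := KS_DeltaN nN hP.
by rewrite !kernE ?subr0 // /C1 /D1 /=; ring.
Qed.

(** Stated for the combination itself rather than for [P], so that it also serves the companion of
    degree [n - 1]. *)
Lemma C1D1_lowering n x : (1 < n)%N -> (n <= N)%N ->
  x * Nabla (fun t => C1 N p lam mu j n t * K n t + D1 N p lam mu j n t * K n.-1 t) x
  = E1 N p lam mu j n x * K n x + F1 N p lam mu j n x * K n.-1 x.
Proof.
case: n => [|[|n]] // _ nN /=.
rewrite /E1 /F1 /=; set C := C1 _ _ _ _ _ _; set D := D1 _ _ _ _ _ _.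
have b0 : beta N p n.+1 != 0 by rewrite gt_eqF // beta_gt0 // ltnW.
have l1 := Kr_lowering p_gt0 x nN; have l2 := Kr_lowering p_gt0 x (ltnW nN).
have r := Kr_rec p_gt0 x nN; rewrite /= in r.
(* Lowering [K n.+1] produces [K n]; the recurrence returns it to the pair [K n.+2], [K n.+1]. *)
have K0 : K n x = ((x - alpha N p n.+1) * K n.+1 x - K n.+2 x) / beta N p n.+1.
  by rewrite r; field.
transitivity (x * Nabla C x * K n.+2 x + C (x - 1) * (x * Nabla (K n.+2) x)
   + x * Nabla D x * K n.+1 x + D (x - 1) * (x * Nabla (K n.+1) x)).
  by rewrite /Nabla; ring.
rewrite l1 l2 K0 -!natr1; by field.
Qed.

End KravchukSobolev.

(** * Elimination and the second-order equation *)

Lemma second_order_elimination (F : fieldType) (T T' a21 a21' a11 a11' a12 a22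
    u0 u1 u2 v0 v1 : F) :
  a11 != 0 ->
  T * (u0 - u1) = - a21 * u0 + a11 * v0 ->
  T' * (u1 - u2) = - a21' * u1 + a11' * v1 ->
  T * (v0 - v1) = a22 * u0 - a12 * v0 ->
  T * T' * (u0 - u1 - (u1 - u2))
  + (T * (T - T' + a21' + a12) - (a11 - a11') * (T + a12) * T / a11) * (u0 - u1)
  + (T * (a21 - a21') + a12 * a21 - (a11 - a11') * a21 * (T + a12) / a11 - a11' * a22) * u0
  = 0.
Proof.
move=> a0 /eqP; rewrite -subr_eq0 => /eqP e1 /eqP; rewrite -subr_eq0 => /eqP e2 /eqP.
rewrite -subr_eq0 => /eqP e3.
(* The first multiplier equals [(T + a12) * a11' / a11]; with these three multipliers both [v0] and
   [v1] cancel. *)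
transitivity ((T + (a12 - (T + a12) * (a11 - a11') / a11))
     * (T * (u0 - u1) - (- a21 * u0 + a11 * v0))
   - T * (T' * (u1 - u2) - (- a21' * u1 + a11' * v1))
   + a11' * (T * (v0 - v1) - (a22 * u0 - a12 * v0))); first by field.
by rewrite e1 e2 e3 !mulr0 subr0 addr0.
Qed.

Theorem mainTheorem7 (R : realFieldType) (N : nat) (p lam mu : R) (j : nat)
  (n : nat) (P : {poly R}) (x : R) :
  0 < p -> p < 1 -> 0 < lam -> 0 < mu ->
  (3 <= n)%N -> (n <= N)%N ->
  is_KS N p lam mu j n P ->
  (* Theta_n and Lambda_n(.;i,k) defined at x and at x-1 *)
  regular_pt N j x -> regular_pt N j (x - 1) -> regular_pt N j (x - 2) ->
  Lam N p lam mu j n 1 1 x != 0 ->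
  Fcal N p lam mu j n x * Nabla (Nabla (fun t => P.[t])) x
  + Gcal N p lam mu j n x * Nabla (fun t => P.[t]) x
  + Hcal N p lam mu j n x * P.[x] = 0.
Proof.
move=> p0 p1 l0 m0 n3 nN hP r0 r1 r2 L0.
have n1 : (1 < n)%N by exact: ltnW.
have n1' : (1 < n.-1)%N by case: n n3 {nN hP L0 n1} => [|[|[|n]]].
have nN' : (n.-1 <= N)%N by rewrite (leq_trans (leq_pred _)).
have PE t : regular_pt N j t ->
    P.[t] = C1 N p lam mu j n t * Kr N p n t + D1 N p lam mu j n t * Kr N p n.-1 t.
  by apply: KS_connection => //; apply: ltnW.
(* The degree [n - 1] Kravchuk-Sobolev polynomial, through its connection formula only. *)
pose v t := C1 N p lam mu j n.-1 t * Kr N p n.-1 t + D1 N p lam mu j n.-1 t * Kr N p n.-2 t.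
have b0 : beta N p n.-1 != 0 by rewrite gt_eqF // beta_gt0 // ltnW.
have K2 t : Kr N p n.-2 t = ((t - alpha N p n.-1) * Kr N p n.-1 t - Kr N p n t) / beta N p n.-1.
  have := @Kr_rec _ N p p0 n.-1 t; rewrite prednK; last by rewrite ltnW // ltnW.
  by move=> -> //; field.
have vE t : v t = C2 N p lam mu j n t * Kr N p n t + D2 N p lam mu j n t * Kr N p n.-1 t.
  by rewrite /v K2 /D2 /C2; field.
have eu t : regular_pt N j t -> regular_pt N j (t - 1) ->
    t * Nabla (horner P) t = E1 N p lam mu j n t * Kr N p n t + F1 N p lam mu j n t * Kr N p n.-1 t.
  by move=> rt rt'; rewrite -C1D1_lowering // /Nabla !PE.
have ev t : t * Nabla v t = E2 N p lam mu j n t * Kr N p n t + F2 N p lam mu j n t * Kr N p n.-1 t.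
  by rewrite C1D1_lowering // K2 /F2 /E2; field.
(* Cramer's rule: [C1 D2 - C2 D1] times [K_n] is [D2 P - D1 v], and times [K_(n-1)] is
   [C1 v - C2 P]. *)
have su t : regular_pt N j t -> regular_pt N j (t - 1) ->
    Theta N p lam mu j n t * Nabla (horner P) t
    = - Lam N p lam mu j n 2 1 t * P.[t] + Lam N p lam mu j n 1 1 t * v t.
  move=> rt rt'; rewrite /Theta mulrAC eu // PE // vE /Lam /Ei /Fi /Ci /Di /=; ring.
have sv : Theta N p lam mu j n x * Nabla v x
    = Lam N p lam mu j n 2 2 x * P.[x] - Lam N p lam mu j n 1 2 x * v x.
  by rewrite /Theta mulrAC ev PE // vE /Lam /Ei /Fi /Ci /Di /=; ring.
(* The relation for [P] is also used at [x - 1], which reaches back to [x - 2]. *)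
have x2 : x - 1 - 1 = x - 2 by ring.
rewrite /Fcal /Gcal /Hcal /Nabla.
apply: second_order_elimination L0 (su x r0 r1) (su (x - 1) r1 _) sv.
by rewrite x2.
Qed.
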